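(* Let $r \geq 1$ and let $n_1,\ldots,n_r$ be positive integers. Let $q_1,\ldots,q_r$ be indeterminates. Then $$ \begin{aligned} \sum_{T \in \mathrm{Tree}(K_{n_1} \times \cdots \times K_{n_r})} q^{\mathrm{dir}(T)} &= \frac{1}{n_1 \cdots n_r}\prod_{\emptyset \neq A \subseteq [r]} \left( \sum_{i \in A} q_i n_i \right)^{\prod_{i \in A}(n_i-1)} \\ &= \left(\prod_{i=1}^r q_i^{n_i-1} n_i^{n_i-2}\right) \prod_{\substack{A \subseteq [r] \\ |A| \geq 2}} \left( \sum_{i \in A} q_i n_i \right)^{\prod_{i \in A}(n_i-1)} . \end{aligned} $$
   Context: Notation: $[m]=\{1,2,\ldots,m\}$. $K_m$ is the complete graph on vertex set $[m]$. The Cartesian product $K_{n_1}\times\cdots\times K_{n_r}$ is the graph whose vertices are the $r$-tuples $(j_1,\ldots,j_r)\in[n_1]\times\cdots\times[n_r]$, with an edge joining two $r$-tuples exactly when they differ in exactly one coordinate. An edge is said to lie in direction $i$ if its two endpoints differ in their $i$-th coordinate. $\mathrm{Tree}(G)$ denotes the set of all spanning trees of a graph $G$. For a spanning tree $T$ of $K_{n_1}\times\cdots\times K_{n_r}$, the direction monomial is $$q^{\mathrm{dir}(T)}:=\prod_{i=1}^r q_i^{|\{\text{edges in } T \text{ in direction } i\}|}.$$ *)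

(* Defs.v *)
From HB Require Import structures.
From mathcomp Require Import all_boot all_order all_algebra.
From mathcomp Require Import mpoly.

Set Implicit Arguments.
Unset Strict Implicit.
Unset Printing Implicit Defensive.

Import GRing.Theory.
Local Open Scope ring_scope.

Section SpanningTrees.
Variable V : finType.
Implicit Types (adj : rel V) (T : {set {set V}}).

(* A finite simple graph on V is given by its symmetric irreflexive adjacency
   relation; an edge is the two-element set of its endpoints, and a spanning
   subgraph is identified with its set of edges. *)
Definition edges adj : {set {set V}} :=
  [set [set p.1; p.2] | p in [set p : V * V | adj p.1 p.2]].

Definition edge_rel T : rel V := fun x y => [set x; y] \in T.

Definition connected T : bool :=
  [forall x, forall y, connect (edge_rel T) x y].

(* A cycle is a cyclic sequence of at least three distinct vertices; as these
   are distinct, there are at most #|V| of them (see [acyclicP]). *)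
Definition acyclic T : bool :=
  [forall k : 'I_#|V|.+1, forall s : k.-tuple V,
     (2 < k)%N ==> ~~ ucycleb (edge_rel T) s].

Lemma acyclicP T :
  reflect (forall s : seq V, (2 < size s)%N -> ~ ucycle (edge_rel T) s)
          (acyclic T).
Proof.
apply: (iffP forallP) => [H s s2 cs | H k].
  have us : uniq s by case/andP: cs.
  have ks : (size s < #|V|.+1)%N by rewrite ltnS -(card_uniqP us) max_card.
  by move: (H (Ordinal ks)) => /forallP /(_ (in_tuple s)) /implyP /(_ s2) /negP.
apply/forallP => s; apply/implyP => k2; apply/negP.
by apply: H; rewrite size_tuple.
Qed.

Definition Tree adj : {set {set {set V}}} :=
  [set T : {set {set V}} | [&& T \subset edges adj, connected T & acyclic T]].

End SpanningTrees.

Section ProductOfCompleteGraphs.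
Variables (r : nat) (n : 'I_r -> nat).

Definition prod_vertex : finType := {dffun forall i : 'I_r, 'I_(n i)}.

Definition prod_complete : rel prod_vertex :=
  fun x y => #|[set i | x i != y i]| == 1%N.

Lemma prod_complete_sym : ssrbool.symmetric prod_complete.
Proof.
by move=> x y; congr (_ == _); apply: eq_card => i; rewrite !inE eq_sym.
Qed.

Lemma prod_complete_irr : irreflexive prod_complete.
Proof.
move=> x; apply/negbTE; rewrite /prod_complete (_ : [set _ | _] = set0) ?cards0 //.
by apply/setP => i; rewrite !inE eqxx.
Qed.

Definition in_direction (i : 'I_r) (e : {set prod_vertex}) : bool :=
  [exists x in e, exists y in e, x i != y i].

Definition dir_monomial (T : {set {set prod_vertex}}) : {mpoly rat[r]} :=
  \prod_(i < r) 'X_i ^+ #|[set e in T | in_direction i e]|.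

End ProductOfCompleteGraphs.

(* Main.v *)
Require Import Defs.
From HB Require Import structures.
From mathcomp Require Import all_boot all_order all_algebra all_fingroup.
From mathcomp Require Import mpoly zify.

Set Implicit Arguments.
Unset Strict Implicit.
Unset Printing Implicit Defensive.

Import GRing.Theory.
Local Open Scope ring_scope.

(** The proof computes one determinant in two ways.  Let G be a graph whose
    edges e carry weights W e, let L be its weighted Laplacian, and let c be the
    unit vector of a chosen root vertex rho.

    Combinatorial side ([matrix_tree]).  Row v of L + c c^T is a weighted sum,
    over the possible targets of v (a neighbour u of v, or, for v = rho, the
    outside), of the vectors e_v - e_u, with e_u replaced by 0 for the outside.
    Expanding the determinant by multilinearity in the rows gives a sum over all
    maps f sending each vertex to a target, each weighted by the determinant of
    the matrix with rows e_v - e_(f v).  That determinant is 1 if iterating f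
    leads every vertex outside and 0 if some vertex is caught in a cycle
    ([det_escape_grounded], [det_escape_ungrounded]).  The surviving maps of
    nonzero weight are the orientations of the spanning trees towards rho, and
    each spanning tree has exactly one ([Tree_arc_edges], [arc_edges_inj]).
    Hence det (L + c c^T) is the sum over spanning trees T of the product of the
    W e for e in T.

    Spectral side ([det_rooted_product_laplacian]).  For the product of complete
    graphs with weight q_i in direction i, L is the sum over i of q_i times the
    Laplacian n_i I - J of K_(n_i) acting on coordinate i.  The latter has the
    eigenbasis formed by the all-ones vector (eigenvalue 0) and the vectors
    e_b - e_o for b <> o (eigenvalue n_i), so the tensor products of these
    vectors are an eigenbasis of L: the one indexed by j has eigenvalue the sum
    of q_i n_i over the set A of coordinates with j_i <> o_i, and a given A
    arises from prod_(i in A) (n_i - 1) indices j.  In this basis L + c c^T is a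
    diagonal matrix with one zero entry plus a matrix of rank one, and its
    determinant is the product of the nonzero eigenvalues times
    1 / (n_1 ... n_r) ([det_rank1_eigenbasis]).

    With q_i the indeterminate 'X_i this is the first formula.  The second one
    separates the factors with #|A| = 1, which are (q_i n_i)^(n_i - 1). *)

(** * Products of sums, and matrices indexed by finite types *)

(** Counterpart of [bigA_distr_bigA] for dependent functions. *)
Lemma prod_sum_dffun (R : comPzSemiRingType) (I : finType) (T : I -> finType)
    (F : forall i, T i -> R) :
  \prod_i \sum_(a : T i) F i a
    = \sum_(y : {dffun forall i, T i}) \prod_i F i (y i).
Proof.
rewrite (reindex (@dffun_of_fprod I T)); last exact/onW_bij/dffun_of_fprod_bij.
under [RHS]eq_bigr => t _.
  under eq_bigr => i _ do rewrite ffunE -[F i _](ffunE (F i)).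
  over.
rewrite (@big_fprod _ _ _ _ +%R I T (fun i => [ffun a => F i a])).
transitivity (\prod_i \sum_(u in tagged_with T i) untag 0 [ffun a => F i a] u).
  apply: eq_bigr => i _.
  transitivity (\sum_(a : T i) [ffun a => F i a] a).
    by apply: eq_bigr => a _; rewrite ffunE.
  exact: (big_tag (op := +%R) (fun i => [ffun a => F i a])).
exact: (bigA_distr_big_dep (times := *%R) (plus := +%R)).
Qed.

Definition finmx (R : Type) (V J : finType) (M : V -> J -> R) :
    'M_(#|V|, #|J|) :=
  \matrix_(a, b) M (enum_val a) (enum_val b).

Lemma mulmx_finmx (R : pzSemiRingType) (V J K : finType)
    (M : V -> J -> R) (N : J -> K -> R) :
  finmx M *m finmx N = finmx (fun x z => \sum_y M x y * N y z).
Proof.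
apply/matrixP => a b; rewrite !mxE [RHS](reindex _ (onW_bij _ (enum_val_bij J))).
by apply: eq_bigr => c _; rewrite !mxE.
Qed.

Lemma finmx1 (R : pzSemiRingType) (V : finType) :
  finmx (fun x y : V => (x == y)%:R) = 1%:M :> 'M[R]_#|V|.
Proof. by apply/matrixP => a b; rewrite !mxE (inj_eq enum_val_inj). Qed.

Lemma eq_finmx (R : Type) (V J : finType) (M N : V -> J -> R) :
  (forall x y, M x y = N x y) -> finmx M = finmx N.
Proof. by move=> MN; apply/matrixP => a b; rewrite !mxE. Qed.

Lemma sum_pick (R : pzSemiRingType) (V : finType) (v : V) (F : V -> R) :
  \sum_u (u == v)%:R * F u = F v.
Proof.
rewrite (bigD1 v) //= eqxx mul1r big1 ?addr0 // => u /negPf ->.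
by rewrite mul0r.
Qed.

(** * Determinants of rank-one updates *)

(** A permutation other than the identity moves some index besides k, so it
    contributes a vanishing entry to the Leibniz formula. *)
Lemma det_diag_off_row (R : comPzRingType) N (k : 'I_N) (M : 'M[R]_N) :
  (forall i j, i != k -> i != j -> M i j = 0) -> \det M = \prod_i M i i.
Proof.
move=> M0; rewrite /determinant (bigD1 (1%g : {perm 'I_N})) //=.
rewrite [X in _ + X]big1 ?addr0 => [|s s1].
  by rewrite odd_perm1 expr0 mul1r; apply: eq_bigr => i _; rewrite perm1.
have [i ik si] : exists2 i, i != k & i != s i.
  have [i si] : exists i, s i != i.
    apply/existsP; apply: contraR s1; rewrite negb_exists => /forallP s_fix.
    by apply/eqP/permP => i; rewrite perm1; apply/eqP/negPn/s_fix.
  have [eik|ik] := eqVneq i k; last by exists i => //; rewrite eq_sym.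
  exists (s i); first by rewrite -eik.
  by rewrite (inj_eq perm_inj) eq_sym.
by rewrite (bigD1 i) //= M0 // mul0r mulr0.
Qed.

(** When entry k of the diagonal d vanishes, diag d + x y is the product of
    [C], the identity with column k replaced by x, and of diag d with row k
    replaced by y; both factors have the determinant of a triangular matrix. *)
Lemma det_diag_rank1 (R : comNzRingType) N (k : 'I_N)
    (d y : 'rV[R]_N) (x : 'cV[R]_N) :
  d 0 k = 0 ->
  \det (diag_mx d + x *m y) = x k 0 * y 0 k * \prod_(j | j != k) d 0 j.
Proof.
move=> dk.
pose e : 'cV[R]_N := delta_mx k 0; pose C := 1%:M + (x - e) *m e^T.
have ->: diag_mx d + x *m y = C *m (diag_mx d + e *m y).
  rewrite /C mulmxDl mul1mx -mulmxA mulmxDr mulmxA trmx_delta.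
  have ->: delta_mx 0 k *m diag_mx d = 0 :> 'rV[R]_N.
    rewrite mul_mx_diag; apply/matrixP => i j; rewrite !mxE.
    by have [->|_] := eqVneq j k; rewrite ?dk ?mulr0 ?andbF ?mul0r.
  rewrite add0r mul_delta_mx -addrA; congr (_ + _).
  suff -> : delta_mx 0 0 = 1%:M :> 'M[R]_1.
    by rewrite mul1mx mulmxBl addrC subrK.
  by apply/matrixP => i j; rewrite [i]ord1 [j]ord1 !mxE !eqxx.
have CE i j : C i j = (i == j)%:R + (x i 0 - (i == k)%:R) * (j == k)%:R.
  by rewrite !mxE big_ord1 !mxE !eqxx !andbT.
have DE i j : (diag_mx d + e *m y) i j = d 0 i *+ (i == j) + (i == k)%:R * y 0 j.
  by rewrite !mxE big_ord1 !mxE !eqxx andbT.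
(* The transpose of C is diagonal outside its row k. *)
rewrite det_mulmx -[\det C]det_tr.
rewrite (det_diag_off_row (k := k)) => [|i j ik ij]; last first.
  by rewrite mxE CE (negPf ik) eq_sym (negPf ij) mulr0 add0r.
rewrite (det_diag_off_row (k := k)) => [|i j ik ij]; last first.
  by rewrite DE (negPf ik) (negPf ij) mul0r add0r.
rewrite (bigD1 k) //= [X in _ * X](bigD1 k) //= mxE CE DE.
rewrite !eqxx dk mul1r mulr1 add0r addrC subrK big1 => [|i ik]; last first.
  by rewrite mxE CE !eqxx (negPf ik) mulr0 addr0.
rewrite mulr1 mulrA; congr (_ * _); apply: eq_bigr => i ik.
by rewrite DE eqxx (negPf ik) mul0r addr0 mulr1n.
Qed.

(** The columns of P are an eigenbasis of M, with dual basis the rows of Q, and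
    o is the index of a kernel vector.  In this basis M becomes diagonal and the
    matrix unit at (rho, rho) becomes column rho of Q times row rho of P. *)
Lemma det_rank1_eigenbasis (R : comNzRingType) (V : finType)
    (M P Q : V -> V -> R) (lam : V -> R) (o rho : V) :
  (forall x y, \sum_z Q x z * P z y = (x == y)%:R) ->
  (forall x j, \sum_y M x y * P y j = P x j * lam j) ->
  lam o = 0 ->
  \det (finmx (fun x y => M x y + ((x == rho) && (y == rho))%:R))
    = Q o rho * P rho o * \prod_(j | j != o) lam j.
Proof.
move=> QP MP lam0.
set A := finmx _.
pose x : 'cV_#|V| := \col_a Q (enum_val a) rho.
pose y : 'rV_#|V| := \row_b P rho (enum_val b).
pose d : 'rV_#|V| := \row_b lam (enum_val b).
have QP1 : finmx Q *m finmx P = 1%:M.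
  by rewrite mulmx_finmx -finmx1; apply: eq_finmx => u v; rewrite QP.
have QAP : finmx Q *m (A *m finmx P) = diag_mx d + x *m y.
  have -> : A *m finmx P
      = finmx P *m diag_mx d + (\col_a (enum_val a == rho)%:R) *m y.
    apply/matrixP => a b; rewrite mulmx_finmx mul_mx_diag !mxE big_ord1 !mxE.
    rewrite -MP -(sum_pick rho (fun u => (enum_val a == rho)%:R * P u _)) -big_split /=.
    apply: eq_bigr => u _; rewrite mulrDl mulrA -natrM mulnb.
    by rewrite andbC.
  rewrite mulmxDr !mulmxA QP1 mul1mx; congr (_ + _ *m _).
  apply/matrixP => a b; rewrite !mxE.
  rewrite -(sum_pick rho (fun u => Q _ u)).
  rewrite [RHS](reindex _ (onW_bij _ (enum_val_bij V))).
  by apply: eq_bigr => c _; rewrite !mxE mulrC.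
have -> : \det A = \det (finmx Q *m (A *m finmx P)).
  by rewrite !det_mulmx mulrCA -det_mulmx QP1 det1 mulr1.
rewrite QAP (det_diag_rank1 (k := enum_rank o)) !mxE ?enum_rankK //.
congr (_ * _); rewrite [RHS](reindex _ (onW_bij _ (enum_val_bij V))).
apply: eq_big => [a|a _]; last by rewrite !mxE.
by rewrite -(inj_eq enum_val_inj) enum_rankK.
Qed.

(** * The weighted Laplacian of a product of complete graphs *)

(** Coordinate a of the eigenvector of index b of the complete graph on T: the
    all-ones vector for b = o, and e_b - e_o otherwise. *)
Definition basis_entry (R : pzRingType) (T : finType) (o a b : T) : R :=
  if b == o then 1 else (a == b)%:R - (a == o)%:R.

(** Row b of the inverse of [basis_entry]: any vector x is the mean of its
    coordinates times the all-ones vector, plus, for each b <> o, the difference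
    of x_b and that mean times e_b - e_o. *)
Definition dual_entry (R : unitRingType) (T : finType) (o b a : T) : R :=
  if b == o then #|T|%:R^-1 else (a == b)%:R - #|T|%:R^-1.

Lemma sum_basis_entry (R : pzRingType) (T : finType) (o b : T) :
  \sum_a basis_entry R o a b = #|T|%:R * (b == o)%:R.
Proof.
rewrite /basis_entry; case: eqP => _; first by rewrite sumr_const mulr1.
rewrite sumrB mulr0.
under eq_bigr do rewrite -[_%:R]mulr1; rewrite sum_pick.
by under eq_bigr do rewrite -[_%:R]mulr1; rewrite sum_pick subrr.
Qed.

Lemma dual_basis_entry (R : unitRingType) (T : finType) (o b c : T) :
  #|T|%:R \is a @GRing.unit R ->
  \sum_a dual_entry R o b a * basis_entry R o a c = (b == c)%:R.
Proof.
move=> Tu; rewrite /dual_entry; have [->|bo] := eqVneq b o.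
  by rewrite -mulr_sumr sum_basis_entry mulrA mulVr // mul1r eq_sym.
under eq_bigr do rewrite mulrBl.
rewrite sumrB sum_pick -mulr_sumr sum_basis_entry mulrA mulVr // mul1r.
rewrite /basis_entry; case: (eqVneq c o) => [->|co].
  by rewrite (negPf bo) subrr.
by rewrite (negPf bo) !subr0.
Qed.

Lemma dffun_eqE (R : comPzSemiRingType) (I : finType) (T : I -> finType)
    (x y : {dffun forall i, T i}) :
  ((x == y)%:R : R) = \prod_i (x i == y i)%:R.
Proof.
have [->|xy] := eqVneq x y; first by rewrite big1 // => i _; rewrite eqxx.
have [i xyi] : exists i, x i != y i.
  apply/existsP; apply: contraR xy; rewrite negb_exists => /forallP xy.
  by apply/eqP/ffunP => i; apply/eqP/negPn/xy.
by rewrite (bigD1 i) //= (negPf xyi) mul0r.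
Qed.

Section ProductLaplacian.
Variables (R : comUnitRingType) (I : finType) (T : I -> finType).
Variables (o : forall i, T i) (q : I -> R).
Notation V := {dffun forall i, T i}.

Definition agree_off (i : I) (x y : V) : bool :=
  [forall k, (k != i) ==> (x k == y k)].

Lemma agree_offE i x y :
  (agree_off i x y)%:R = \prod_k (if k == i then 1 else (x k == y k)%:R) :> R.
Proof.
case: (boolP (agree_off i x y)) => [/forallP xy|].
  by rewrite big1 // => k _; case: (eqVneq k i) (xy k) => //= _ ->.
rewrite negb_forall => /existsP[k]; rewrite negb_imply => /andP[ki xyk].
by rewrite (bigD1 k) //= (negPf ki) (negPf xyk) mul0r.
Qed.

(** In direction i this is q_i (#|T i| I - J), since x and y lie on a common
    line in direction i, or are equal, when they agree off i. *)
Definition product_laplacian (x y : V) : R :=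
  \sum_i q i * (#|T i|%:R * (x == y)%:R - (agree_off i x y)%:R).

Definition origin : V := [ffun i => o i].

Definition eigenvector (x j : V) : R := \prod_i basis_entry R (o i) (x i) (j i).

Definition offset_dirs (j : V) : {set I} := [set i | j i != o i].

Definition eigenvalue_at (j : V) : R :=
  \sum_(i in offset_dirs j) q i * #|T i|%:R.

(** Both parts of the summand for direction i are tensor products, so the sum
    over y factors over the coordinates.  The all-ones part J maps factor i of
    the eigenvector to its coordinate sum, which is #|T i| or 0 according to
    whether j i = o i. *)
Lemma product_laplacian_eigenvector x j :
  \sum_y product_laplacian x y * eigenvector y j
    = eigenvector x j * eigenvalue_at j.
Proof.
rewrite /eigenvalue_at [in RHS]big_mkcond mulr_sumr /=.
under eq_bigr => y _ do rewrite mulr_suml.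
rewrite exchange_big; apply: eq_bigr => i _ /=.
under eq_bigr => y _ do rewrite -mulrA mulrBl -mulrA mulrBr.
rewrite sumrB -!mulr_sumr.
under eq_bigr => y _ do rewrite eq_sym.
rewrite sum_pick -mulrBr inE.
have -> : \sum_y (agree_off i x y)%:R * eigenvector y j
    = #|T i|%:R * (j i == o i)%:R
      * \prod_(k | k != i) basis_entry R (o k) (x k) (j k).
  under [LHS]eq_bigr => y _ do rewrite agree_offE -big_split /=.
  rewrite -(prod_sum_dffun (fun k a => (if k == i then 1 else (x k == a)%:R)
    * basis_entry R (o k) a (j k))) (bigD1 i) //=.
  congr (_ * _).
    by rewrite eqxx -sum_basis_entry; apply: eq_bigr => a _; rewrite mul1r.
  apply: eq_bigr => k /negPf ->.
  by under eq_bigr => a _ do rewrite eq_sym; rewrite sum_pick.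
have [jo|_] := eqVneq (j i) (o i); last first.
  by rewrite mulr0 mul0r subr0 mulrA mulrC.
rewrite /eigenvector (bigD1 i) //= {1}/basis_entry jo eqxx.
by rewrite mul1r mulr1 subrr !mulr0.
Qed.

Lemma offset_dirs_eq0 j : (offset_dirs j == set0) = (j == origin).
Proof.
apply/eqP/eqP => [/setP j0|->]; last by apply/setP => i; rewrite !inE ffunE eqxx.
by apply/ffunP => i; have := j0 i; rewrite !inE ffunE => /negbFE/eqP.
Qed.

Lemma card_offset_dirs (A : {set I}) :
  #|[set j | offset_dirs j == A]| = (\prod_(i in A) (#|T i| - 1))%N.
Proof.
(* The indicator of the fibre is a product over the coordinates. *)
transitivity (\sum_(j : V) \prod_i ((j i != o i) == (i \in A) : nat))%N.
  rewrite -sum1_card big_mkcond; apply: eq_bigr => j _ /=.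
  rewrite inE; have [<-|jA] := eqVneq (offset_dirs j) A.
    by rewrite big1 // => i _; rewrite inE eqxx.
  have [i /negPf Ai] : exists i, (j i != o i) != (i \in A).
    apply/existsP; apply: contraR jA; rewrite negb_exists => /forallP jA.
    by apply/eqP/setP => i; rewrite inE; have /negPn/eqP := jA i.
  by rewrite (bigD1 i) //= Ai mul0n.
rewrite -(prod_sum_dffun (fun i a => ((a != o i) == (i \in A) : nat))).
rewrite [RHS]big_mkcond; apply: eq_bigr => i _; case: ifP => iA.
  rewrite subn1 -(cardC1 (o i)) -sum1_card [RHS]big_mkcond.
  by apply: eq_bigr => a _; rewrite eqb_id !inE; case: eqP.
rewrite -[RHS](card1 (o i)) -sum1_card [RHS]big_mkcond.
by apply: eq_bigr => a _; rewrite eqbF_neg negbK !inE; case: eqP.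
Qed.

Lemma det_rooted_product_laplacian :
  (forall i, (#|T i|%:R : R) \is a GRing.unit) ->
  \det (finmx (fun x y => product_laplacian x y
                            + ((x == origin) && (y == origin))%:R))
    = \prod_i #|T i|%:R^-1
      * \prod_(A : {set I} | A != set0)
          (\sum_(i in A) q i * #|T i|%:R) ^+ (\prod_(i in A) (#|T i| - 1))%N.
Proof.
move=> Tu.
pose dual (j x : V) : R := \prod_i dual_entry R (o i) (j i) (x i).
have lam0 : eigenvalue_at origin = 0.
  by rewrite /eigenvalue_at big_pred0 // => i; rewrite inE ffunE eqxx.
have dual_eigen x y : \sum_z dual x z * eigenvector z y = (x == y)%:R.
  under eq_bigr => z _ do rewrite -big_split /=.
  rewrite -(prod_sum_dffun (fun i a => dual_entry R (o i) (x i) a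
    * basis_entry R (o i) a (y i))) dffun_eqE.
  by apply: eq_bigr => i _; rewrite dual_basis_entry.
have LP := product_laplacian_eigenvector.
rewrite (det_rank1_eigenbasis origin dual_eigen LP lam0).
have -> : dual origin origin = \prod_i #|T i|%:R^-1.
  by apply: eq_bigr => i _; rewrite /dual_entry ffunE eqxx.
have -> : eigenvector origin origin = 1.
  by rewrite /eigenvector big1 // => i _; rewrite /basis_entry ffunE eqxx.
rewrite mulr1; congr (_ * _).
rewrite (partition_big offset_dirs (fun A => A != set0)) /= => [|j]; last first.
  by rewrite offset_dirs_eq0.
apply: eq_bigr => A A0; rewrite -card_offset_dirs -prodr_const.
apply: eq_big => [j|j /andP[_ /eqP <-]] //.
rewrite inE -offset_dirs_eq0.
by have [->|_] := eqVneq (offset_dirs j) A; rewrite ?A0 ?andbF.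
Qed.

End ProductLaplacian.

(** * Maps all of whose orbits escape *)

Section GroundedMaps.
Variable V : finType.
Implicit Types (f g : {ffun V -> option V}) (v u : V).

(** [f v = None] means that f sends v to the outside of V; f is grounded when
    every orbit ends there, that is, when f encodes a rooted forest. *)
Definition grounded f : bool := [forall v, fconnect (obind f) (Some v) None].

(** Well-founded induction along f, from the targets to their preimages. *)
Lemma grounded_ind f (P : V -> Prop) :
  grounded f -> (forall v, (forall u, f v = Some u -> P u) -> P v) ->
  forall v, P v.
Proof.
move=> /forallP gf step v; have := iter_findex (gf v).
move: (findex _ _ _) => k; elim: k v => [|k IHk] v //.
by rewrite iterSr /= => fv; apply: step => u fvu; apply: IHk; rewrite -fvu.
Qed.

Lemma grounded_step f (d : V -> nat) :
  (forall v u, f v = Some u -> d u < d v)%N -> grounded f.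
Proof.
move=> fd; apply/forallP => v; have [k] := ubnP (d v).
elim: k v => // k IHk v dv.
apply: connect_trans (fconnect1 _ _) _ => /=.
case fv: (f v) => [u|] //; apply: IHk.
by apply: leq_trans (fd _ _ fv) _.
Qed.

Definition depth f v := findex (obind f) (Some v) None.

Lemma depth_step f v u :
  grounded f -> f v = Some u -> depth f v = (depth f u).+1.
Proof. by move=> /forallP gf fv; rewrite /depth fconnect_findex //= fv. Qed.

Lemma grounded_asym f v u :
  grounded f -> f v = Some u -> f u <> Some v.
Proof.
by move=> gf fv fu; have := depth_step gf fv; rewrite (depth_step gf fu); lia.
Qed.

(** If g orients every arc of f in one of the two ways and reverses one of them,
    v -> u, then it cannot keep the arc of f that leaves u, so it reverses that
    one as well; this goes on along the whole orbit of v, which is impossible as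
    the orbit ends. *)
Lemma grounded_cross f g v u :
  grounded f -> (forall x y, f x = Some y -> g x = Some y \/ g y = Some x) ->
  (forall x, f x = None -> g x = None) ->
  f v = Some u -> g u <> Some v.
Proof.
move=> gf fg fg0; move: v u; apply: (grounded_ind gf) => v IH u fv gu.
case fu: (f u) => [x|]; last by rewrite fg0 in gu.
have [gux|gx] := fg _ _ fu; last exact: (IH _ fv _ fu gx).
by apply: grounded_asym gf fv _; rewrite fu -gux.
Qed.

End GroundedMaps.

Section GroundedDeterminant.
Variables (R : comNzRingType) (V : finType).
Implicit Types (f : {ffun V -> option V}).

(** Row v is e_v - e_(f v), or e_v when f v is the outside. *)
Definition escape f (v u : V) : R := (v == u)%:R - (f v == Some u)%:R.

(** A permutation s contributes to the Leibniz formula only if each index it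
    moves is sent by s where f sends it; by induction along f, such an s moves
    nothing. *)
Lemma det_escape_grounded f : grounded f -> \det (finmx (escape f)) = 1.
Proof.
move=> gf; rewrite /determinant (bigD1 (1%g : {perm 'I_#|V|})) //=.
rewrite [X in _ + X]big1 ?addr0 => [|s s1].
  rewrite odd_perm1 expr0 mul1r big1 // => a _.
  rewrite perm1 mxE /escape eqxx; case: eqP => [fa|_]; last by rewrite subr0.
  by case: (grounded_asym gf fa).
have [a sa fa] : exists2 a, s a != a & f (enum_val a) != Some (enum_val (s a)).
  apply/exists_inP; apply: contraR s1; rewrite negb_exists_in => /forall_inP sf.
  have sfix: forall v, s (enum_rank v) = enum_rank v.
    apply: (grounded_ind gf) => v IH; apply/eqP; apply: contraT => sv.
    have /negPn/eqP := sf _ sv; rewrite enum_rankK => /IH.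
    by rewrite enum_valK => /perm_inj sv'; rewrite sv' eqxx in sv.
  by apply/eqP/permP => a; rewrite perm1 -[a]enum_valK sfix.
rewrite (bigD1 a) //= mxE /escape (inj_eq enum_val_inj) eq_sym.
by rewrite (negPf sa) (negPf fa) subrr mul0r mulr0.
Qed.

(** The indicator vector of the vertices that never get outside is in the
    kernel. *)
Lemma det_escape_ungrounded f : ~~ grounded f -> \det (finmx (escape f)) = 0.
Proof.
rewrite negb_forall => /existsP[v0 lost0].
pose lost v := ~~ fconnect (obind f) (Some v) None.
pose x : 'cV[R]_#|V| := \col_a (lost (enum_val a))%:R.
have Bx : finmx (escape f) *m x = 0.
  apply/matrixP => a b; rewrite !mxE.
  transitivity (\sum_u escape f (enum_val a) u * (lost u)%:R).
    rewrite [RHS](reindex _ (onW_bij _ (enum_val_bij V))).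
    by apply: eq_bigr => c _; rewrite !mxE.
  under eq_bigr do rewrite mulrBl eq_sym.
  rewrite sumrB sum_pick /lost fconnect_eqVf /=.
  case fa: (f _) => [u|].
    under eq_bigr do rewrite (inj_eq Some_inj) eq_sym.
    by rewrite sum_pick subrr.
  by rewrite connect0 big1 ?subrr // => u _; rewrite mul0r.
have : \adj (finmx (escape f)) *m (finmx (escape f) *m x) = 0.
  by rewrite Bx mulmx0.
rewrite mulmxA mul_adj_mx mul_scalar_mx.
move/matrixP/(_ (enum_rank v0) 0).
by rewrite !mxE enum_rankK /lost lost0 mulr1.
Qed.

(** Forest expansion of a Laplacian with killing: w v None is the weight of
    leaving V from v.  Row v is the sum over all targets a of w v a (e_v - e_a),
    and the determinant is multilinear in the rows. *)
Lemma det_grounded_expansion (w : V -> option V -> R) :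
  \det (finmx (fun v u => (v == u)%:R * (\sum_o w v o) - w v (Some u)))
    = \sum_(f : {ffun V -> option V} | grounded f) \prod_v w v (f v).
Proof.
transitivity (\sum_(f : {ffun V -> option V})
    \prod_v w v (f v) * \det (finmx (escape f))); last first.
  rewrite [RHS]big_mkcond; apply: eq_bigr => f _; case: ifPn => gf.
    by rewrite det_escape_grounded ?mulr1.
  by rewrite det_escape_ungrounded ?mulr0.
under [RHS]eq_bigr do rewrite mulr_sumr.
rewrite [RHS]exchange_big; apply: eq_bigr => s _ /=.
under [RHS]eq_bigr do rewrite mulrCA.
rewrite -mulr_sumr; congr (_ * _).
pose c v := enum_val (s (enum_rank v)).
transitivity (\prod_v \sum_o w v o * ((v == c v)%:R - (o == Some (c v))%:R)).
  rewrite [RHS](reindex _ (onW_bij _ (enum_val_bij V))).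
  apply: eq_bigr => a _; rewrite mxE /c enum_valK.
  under [RHS]eq_bigr => o _ do rewrite mulrBr [w _ _ * (o == _)%:R]mulrC.
  by rewrite sumrB sum_pick -mulr_suml mulrC.
rewrite bigA_distr_bigA; apply: eq_bigr => f _; rewrite big_split; congr (_ * _).
rewrite (reindex _ (onW_bij _ (enum_val_bij V))).
by apply: eq_bigr => a _; rewrite mxE /c enum_valK.
Qed.

End GroundedDeterminant.

Lemma set2_eqP (V : finType) (x y v u : V) : v != u ->
  [set x; y] = [set v; u] -> (x = v /\ y = u) \/ (x = u /\ y = v).
Proof.
move=> vu E; have xE : x \in [set v; u] by rewrite -E set21.
have yE : y \in [set v; u] by rewrite -E set22.
have vE : v \in [set x; y] by rewrite E set21.
have uE : u \in [set x; y] by rewrite E set22.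
case/set2P: xE vE uE => ->; case/set2P: yE => ->; rewrite !inE ?orbb; auto.
  by rewrite [u == v]eq_sym (negPf vu).
by rewrite (negPf vu).
Qed.
Lemma sum_option (R : nmodType) (V : finType) (F : option V -> R) :
  \sum_a F a = F None + \sum_v F (Some v).
Proof.
rewrite (bigD1 None) //=; congr (_ + _).
rewrite (reindex_omap Some id) => [|[]] //.
by apply: eq_bigl => v /=; rewrite eqxx.
Qed.

(** * Spanning trees as grounded maps *)

Section Arborescences.
Variables (V : finType) (adj : rel V) (rho : V).
Hypotheses (adj_sym : ssrbool.symmetric adj) (adj_irr : irreflexive adj).
Implicit Types (f g : {ffun V -> option V}) (T : {set {set V}}).

Definition arborescence f : bool :=
  [&& grounded f, f rho == None
    & [forall (v | v != rho), if f v is Some u then adj v u else false]].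

(** For an arborescence f, the default value is met only at [v = rho], which
    [arc_edges] leaves out. *)
Definition arc_edge f v : {set V} := [set v; odflt v (f v)].

Definition arc_edges f : {set {set V}} := [set arc_edge f v | v in [set~ rho]].

Lemma edge_rel_sym T : ssrbool.symmetric (edge_rel T).
Proof. by move=> x y; rewrite /edge_rel setUC. Qed.

Lemma mem_edges x y : ([set x; y] \in edges adj) = adj x y.
Proof.
apply/imsetP/idP => [[[a b]] /[!inE] /= ab E|xy]; last first.
  by exists (x, y); rewrite ?inE.
have anb : a != b by apply: contraTneq ab => ->; rewrite adj_irr.
by case: (set2_eqP anb E) => -[-> ->] //; rewrite adj_sym.
Qed.

Section OneArborescence.
Variable f : {ffun V -> option V}.
Hypothesis arbf : arborescence f.

Lemma arborescence_grounded : grounded f.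
Proof. by case/and3P: arbf. Qed.

Lemma arborescence_root : f rho = None.
Proof. by case/and3P: arbf => _ /eqP. Qed.

Lemma arborescence_arc v : v != rho -> exists2 u, f v = Some u & adj v u.
Proof.
case/and3P: arbf => _ _ /forall_inP H /H.
by case: (f v) => [u|] // vu; exists u.
Qed.

Lemma arborescence_None v : f v = None -> v = rho.
Proof.
by move=> fv; apply/eqP; apply: contraT => /arborescence_arc[u]; rewrite fv.
Qed.

Lemma arborescence_neq v u : f v = Some u -> v != u.
Proof.
move=> fv; apply/eqP => vu.
by apply: (grounded_asym arborescence_grounded fv); rewrite -vu fv -vu.
Qed.

Lemma edge_rel_arc_edges x y :
  edge_rel (arc_edges f) x y = (f x == Some y) || (f y == Some x).
Proof.
apply/imsetP/orP => [[v /[!inE] vr E]|xy].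
  have [u fv _] := arborescence_arc vr; move: E; rewrite /arc_edge fv /= => E.
  by case: (set2_eqP (arborescence_neq fv) E) => -[-> ->]; rewrite fv; [left|right].
wlog fx : x y xy / f x = Some y.
  move=> wl; case: (xy) => /eqP fx; first exact: wl.
  by rewrite setUC; apply: wl => //; apply/or_comm.
exists x; last by rewrite /arc_edge fx.
by rewrite !inE; apply/eqP => xr; move: fx; rewrite xr arborescence_root.
Qed.

Lemma arc_edges_connected : connected (arc_edges f).
Proof.
have to_root : forall v, connect (edge_rel (arc_edges f)) v rho.
  apply: (grounded_ind arborescence_grounded) => v IH.
  case fv: (f v) => [u|]; last by rewrite (arborescence_None fv).
  apply: connect_trans (IH _ fv); apply: connect1.
  by rewrite edge_rel_arc_edges fv eqxx.
apply/forallP => x; apply/forallP => y; apply: connect_trans (to_root x) _.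
by rewrite (sym_connect_sym (edge_rel_sym _)).
Qed.

(** At a vertex of maximal depth on a cycle, both neighbours along the cycle are
    its image under f, so they coincide and the cycle has at most two
    vertices. *)
Lemma arc_edges_acyclic : acyclic (arc_edges f).
Proof.
apply/acyclicP => s s3 /andP[cs us].
have gf := arborescence_grounded.
have [v vs vmax] :
    exists2 v, v \in s & forall u, u \in s -> (depth f u <= depth f v)%N.
  case: s s3 {cs us} => // x0 s _.
  have [v vs vmax] := arg_maxnP (P := mem (x0 :: s)) (depth f) (mem_head x0 s).
  by exists v.
have up u : u \in s -> edge_rel (arc_edges f) v u -> f v = Some u.
  move=> us'; rewrite edge_rel_arc_edges => /orP[/eqP //|/eqP fu].
  by have := vmax _ us'; rewrite (depth_step gf fu) ltnn.
have fn : f v = Some (next s v).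
  by apply: up; rewrite ?mem_next // (next_cycle cs).
have fp : f v = Some (prev s v).
  by apply: up; rewrite ?mem_prev // edge_rel_sym (prev_cycle cs).
have np : next s (next s v) = v.
  by rewrite -[RHS](next_prev us); congr next; apply: Some_inj; rewrite -fn.
have [k s' rs] := rot_to vs.
have : next (v :: s') (next (v :: s') v) = v by rewrite -rs !next_rot.
have : uniq (v :: s') by rewrite -rs rot_uniq.
have : (2 < size (v :: s'))%N by rewrite -rs size_rot.
case: s' {rs} => [|a [|b t]] //= _ /andP[].
rewrite !inE eqxx => /norP[va /norP[vb _]] _.
by rewrite eq_sym (negPf va) eqxx => bv; rewrite bv eqxx in vb.
Qed.

Lemma arc_edges_Tree : arc_edges f \in Tree adj.
Proof.
rewrite inE arc_edges_connected arc_edges_acyclic !andbT.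
apply/subsetP => e /imsetP[v /[!inE] /arborescence_arc[u fv vu] ->].
by rewrite /arc_edge fv mem_edges.
Qed.

Lemma arc_edge_inj : {in [set~ rho] &, injective (arc_edge f)}.
Proof.
move=> v x /[!inE] /arborescence_arc[u fv _] /arborescence_arc[y fx _].
rewrite /arc_edge fv fx /= => E.
case: (set2_eqP (arborescence_neq fx) E) => -[vE uE]; first exact: vE.
by case: (grounded_asym arborescence_grounded fx); rewrite -vE fv uE.
Qed.

End OneArborescence.

(** Having the same edges, g keeps or reverses each arc of f, and
    [grounded_cross] rules out the reversals. *)
Lemma arc_edges_inj : {in arborescence &, injective arc_edges}.
Proof.
move=> f g arbf arbg E; have gf := arborescence_grounded arbf.
have cross x y : f x = Some y -> g x = Some y \/ g y = Some x.
  move=> fx; have : edge_rel (arc_edges f) x y.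
    by rewrite edge_rel_arc_edges // fx eqxx.
  by rewrite E edge_rel_arc_edges // => /orP[] /eqP; [left|right].
have cross0 x : f x = None -> g x = None.
  by move=> /(arborescence_None arbf) ->; apply: arborescence_root.
apply/ffunP => v; case fv: (f v) => [u|]; last by rewrite cross0.
have [->|gu] := cross _ _ fv; first by [].
by case: (grounded_cross gf cross cross0 fv gu).
Qed.

Section ParentMap.
Variable T : {set {set V}}.
Hypothesis treeT : T \in Tree adj.

Lemma Tree_path_to_root v :
  exists k, [exists p : k.-tuple V, path (edge_rel T) v p && (last v p == rho)].
Proof.
move: treeT; rewrite inE => /and3P[_ /forallP/(_ v)/forallP/(_ rho) + _].
case/connectP=> p vp rp.
by exists (size p); apply/existsP; exists (in_tuple p); rewrite vp -rp eqxx.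
Qed.

Definition root_dist v := ex_minn (Tree_path_to_root v).

(** Any neighbour that is closer to the root will do: the tree property makes it
    unique. *)
Definition parent : {ffun V -> option V} :=
  [ffun v => if v == rho then None
             else [pick u | edge_rel T v u && (root_dist u < root_dist v)%N]].

Lemma closer_neighbor v :
  v != rho -> exists2 u, edge_rel T v u & (root_dist u < root_dist v)%N.
Proof.
move=> vr; rewrite {2}/root_dist; case: ex_minnP => k /existsP[p /andP[]].
case: p => -[|u p] /= pk; first by move=> _ /eqP vr'; rewrite vr' eqxx in vr.
case/andP => vu up rp _; exists u => //; rewrite /root_dist.
case: ex_minnP => m _ min_m; rewrite -(eqP pk) ltnS; apply: min_m.
by apply/existsP; exists (in_tuple p); rewrite up.
Qed.

Lemma parent_Some v u :
  parent v = Some u ->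
  [/\ v != rho, edge_rel T v u & (root_dist u < root_dist v)%N].
Proof.
rewrite ffunE; case: eqP => // vr; case: pickP => // x /andP[vx dx] [<-].
by split.
Qed.

Lemma edge_rel_Tree_adj x y : edge_rel T x y -> adj x y.
Proof.
by move: treeT; rewrite inE => /and3P[/subsetP sT _ _] /sT; rewrite mem_edges.
Qed.

Lemma parent_arborescence : arborescence parent.
Proof.
apply/and3P; split; last 1 first.
- apply/forall_inP => v vr; case pv: (parent v) => [u|].
    by have [_ /edge_rel_Tree_adj] := parent_Some pv.
  have [u vu du] := closer_neighbor vr.
  by move: pv; rewrite ffunE (negPf vr); case: pickP => // /(_ u); rewrite vu du.
- by apply: (grounded_step (d := root_dist)) => v u /parent_Some[].
by rewrite ffunE eqxx.
Qed.

(** An edge of T that is not an arc of the parent map would close a cycle with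
    the path that joins its ends in the connected graph of the arcs. *)
Lemma arc_edges_parent : arc_edges parent = T.
Proof.
have arbp := parent_arborescence.
have sub x y : edge_rel (arc_edges parent) x y -> edge_rel T x y.
  rewrite edge_rel_arc_edges // => /orP[] /eqP /parent_Some[_ xy _] //.
  by rewrite edge_rel_sym.
move: (treeT); rewrite inE => /and3P[sT _ /acyclicP acT].
apply/eqP; rewrite eqEsubset; apply/andP; split.
  apply/subsetP => e /imsetP[v /[!inE] /(arborescence_arc arbp)[u pv _] ->].
  by rewrite /arc_edge pv; have [] := parent_Some pv.
apply/subsetP => e eT; have /imsetP[[x y] _ /= exy] := subsetP sT _ eT.
rewrite {}exy in eT *; have xy : adj x y by apply: edge_rel_Tree_adj.
apply: contraT => xyN.
have /forallP/(_ x)/forallP/(_ y) := arc_edges_connected arbp.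
case/connectP=> p0 /shortenP[p xp up _] yp.
have p2 : (1 < size p)%N.
  case: p xp up yp => [|z [|//]] /=.
    by move=> _ _ yx; rewrite yx adj_irr in xy.
  by rewrite andbT => xz _ yz; rewrite yz -/(edge_rel _ _ _) xz in xyN.
case: (acT (x :: p) p2); apply/andP; split=> //=.
rewrite rcons_path -yp (sub_path _ xp) //=.
by rewrite edge_rel_sym.
Qed.
End ParentMap.

Lemma Tree_arc_edges : Tree adj = arc_edges @: [set f | arborescence f].
Proof.
apply/setP => T; apply/idP/imsetP => [treeT|[f]]; last first.
  by rewrite inE => arbf ->; apply: arc_edges_Tree.
by exists (parent treeT); rewrite ?inE ?parent_arborescence ?arc_edges_parent.
Qed.

(** * The matrix-tree theorem *)

Variables (R : comNzRingType) (W : {set V} -> R).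

Definition edge_weight v u : R := if adj v u then W [set v; u] else 0.

Definition rooted_weight v (a : option V) : R :=
  if a is Some u then edge_weight v u else (v == rho)%:R.

(** A nonzero weight forces every arc to be an edge and the outside to be
    reached from rho only; rho itself must then go outside, or no orbit would end. *)
Lemma prod_rooted_weight f : grounded f ->
  \prod_v rooted_weight v (f v)
    = if arborescence f then \prod_(e in arc_edges f) W e else 0.
Proof.
move=> gf; case: ifPn => [arbf|].
  rewrite big_imset /=; last exact: arc_edge_inj.
  rewrite (bigD1 rho) //= arborescence_root //= eqxx mul1r.
  apply: eq_big => [v|v vr]; first by rewrite !inE.
  have [u fv vu] := arborescence_arc arbf vr.
  by rewrite /arc_edge fv /= /edge_weight vu.
apply: contraNeq => nz.
have w_neq0 v : rooted_weight v (f v) != 0.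
  by apply: contraNneq nz => w0; rewrite (bigD1 v) //= w0 mul0r.
apply/and3P; split=> //.
  case fr: (f rho) => [x|] //; exfalso.
  apply: (grounded_ind (P := fun=> False) gf _ rho) => v IH.
  case fv: (f v) => [u|]; first exact: IH fv.
  have := w_neq0 v; rewrite fv /=.
  have [vr|_] := eqVneq v rho; last by rewrite eqxx.
  by rewrite vr fr in fv.
apply/forall_inP => v /negPf vr; have := w_neq0 v; case: (f v) => [u|] /=.
  by rewrite /edge_weight; case: ifP; rewrite ?eqxx.
by rewrite vr eqxx.
Qed.

(** Weighted matrix-tree theorem.  Adding 1 to the diagonal entry of the root
    keeps the index set V; the determinant is the usual minor of the
    Laplacian with row and column rho removed, as the Laplacian is singular. *)
Theorem matrix_tree :
  \det (finmx (fun v u =>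
      (v == u)%:R * (\sum_z edge_weight v z) - edge_weight v u
      + ((v == rho) && (u == rho))%:R))
    = \sum_(T in Tree adj) \prod_(e in T) W e.
Proof.
rewrite Tree_arc_edges big_imset /=; last first.
  by move=> f g /[!inE] *; apply: arc_edges_inj.
transitivity (\sum_(f : {ffun V -> option V} | grounded f)
                \prod_v rooted_weight v (f v)).
  rewrite -det_grounded_expansion; congr (\det _); apply: eq_finmx => v u.
  rewrite sum_option /=.
  have [->|vu] := eqVneq v u; rewrite ?mul1r ?mul0r.
    by rewrite andbb addrC addrAC.
  case: (eqVneq v rho) => [vr|_]; last by rewrite addr0 add0r.
  by rewrite -vr eq_sym (negPf vu) addr0 add0r.
rewrite [RHS]big_mkcond [LHS]big_mkcond; apply: eq_bigr => f _ /=.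
rewrite inE; case: ifPn => [/prod_rooted_weight //|gf].
by rewrite /arborescence (negPf gf).
Qed.
End Arborescences.

(** * Spanning trees of products of complete graphs *)

Section ProductTrees.
Variables (R : comUnitRingType) (r : nat) (n : 'I_r -> nat) (q : 'I_r -> R).
Notation V := (prod_vertex n).
Notation T := (fun i => 'I_(n i)).

Definition direction_weight (e : {set V}) : R := \prod_i q i ^+ in_direction i e.

Lemma agree_off_subset i (x y : V) :
  agree_off (T := T) i x y = ([set k | x k != y k] \subset [set i]).
Proof.
apply/forallP/subsetP => [xy k|D k].
  by rewrite !inE; apply: contraR => /(implyP (xy k)).
by apply/implyP; apply: contraR => xyk; have := D k; rewrite !inE => ->.
Qed.

Lemma in_direction_pair i (x y : V) : in_direction i [set x; y] = (x i != y i).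
Proof.
apply/exists_inP/idP => [[a /set2P[]-> /exists_inP[b /set2P[]->]]|xy];
  rewrite ?eqxx //.
  by rewrite eq_sym.
exists x; first exact: set21.
by apply/exists_inP; exists y; first exact: set22.
Qed.

(** Two distinct vertices are adjacent when they agree off a single direction,
    which is then the direction of their edge.  A vertex agrees with itself off
    every direction: the term [x == y] removes these loops. *)
Lemma edge_weight_prod_complete (x y : V) :
  edge_weight (prod_complete (n := n)) direction_weight x y
    = \sum_i q i * ((agree_off (T := T) i x y)%:R - (x == y)%:R).
Proof.
have [->|xy] := eqVneq x y.
  rewrite /edge_weight prod_complete_irr big1 // => i _.
  rewrite agree_off_subset (_ : [set _ | _] = set0) ?sub0set ?subrr ?mulr0 //.
  by apply/setP => k; rewrite !inE eqxx.
under eq_bigr do rewrite subr0 agree_off_subset.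
rewrite /edge_weight /prod_complete /direction_weight.
case: ifPn => [/cards1P[k Dk]|D1].
  rewrite Dk (bigD1 k) //= [RHS](bigD1 k) //= subxx mulr1 in_direction_pair.
  have inD i : (x i != y i) = (i == k) by move/setP/(_ i): Dk; rewrite !inE.
  rewrite inD eqxx expr1 !big1 ?mulr1 ?addr0 // => i ik.
    by rewrite sub1set inE eq_sym (negPf ik) mulr0.
  by rewrite in_direction_pair inD (negPf ik).
rewrite big1 // => i _; rewrite subset1.
have /negPf-> : [set k | x k != y k] != [set i].
  by apply: contra D1 => /eqP->; rewrite cards1.
suff /negPf-> : [set k | x k != y k] != set0 by rewrite mulr0.
apply: contra xy => /eqP/setP D0.
by apply/eqP/ffunP => k; have := D0 k; rewrite !inE => /negbFE/eqP.
Qed.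

Lemma sum_agree_off i (x : V) :
  \sum_y (agree_off (T := T) i x y)%:R = (n i)%:R :> R.
Proof.
under eq_bigr => y _ do rewrite agree_offE.
rewrite -(prod_sum_dffun (T := T)
  (fun k a => if k == i then 1 else (x k == a)%:R)).
rewrite (bigD1 i) //= eqxx sumr_const card_ord big1 ?mulr1 // => k /negPf ->.
under eq_bigr => a _ do rewrite eq_sym -[_%:R]mulr1.
by rewrite sum_pick.
Qed.

Lemma laplacian_prod_complete (x y : V) :
  let w := edge_weight (prod_complete (n := n)) direction_weight in
  (x == y)%:R * (\sum_z w x z) - w x y
    = product_laplacian (T := T) q x y.
Proof.
move=> w; under eq_bigr => z _ do rewrite /w edge_weight_prod_complete.
rewrite /w edge_weight_prod_complete.
rewrite exchange_big mulr_sumr -sumrB; apply: eq_bigr => i _ /=.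
rewrite -mulr_sumr sumrB sum_agree_off.
have -> : \sum_(z : V) (x == z)%:R = 1 :> R.
  by under eq_bigr => z _ do rewrite eq_sym -[_%:R]mulr1; rewrite sum_pick.
rewrite card_ord; have [->|_] := eqVneq x y.
  by rewrite mul1r -mulrBr opprB addrA subrK mulr1.
by rewrite mul0r mulr0 !sub0r subr0 mulrN.
Qed.

(** The tree enumerator with arbitrary direction weights in a commutative ring
    where the n_i are invertible. *)
Theorem product_tree_enumerator :
  (forall i, (0 < n i)%N) -> (forall i, (n i)%:R \is a @GRing.unit R) ->
  \sum_(S in Tree (prod_complete (n := n))) \prod_(e in S) direction_weight e
    = \prod_i (n i)%:R^-1
      * \prod_(A : {set 'I_r} | A != set0)
          (\sum_(i in A) q i * (n i)%:R) ^+ (\prod_(i in A) (n i - 1))%N.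
Proof.
move=> n_gt0 nu; pose o i : 'I_(n i) := Ordinal (n_gt0 i).
rewrite -(matrix_tree (origin o) (@prod_complete_sym r n) (@prod_complete_irr r n)).
transitivity (\det (finmx (fun x y : V =>
    product_laplacian (T := T) q x y
    + ((x == origin o) && (y == origin o))%:R))).
  by congr (\det _); apply: eq_finmx => x y; rewrite laplacian_prod_complete.
rewrite det_rooted_product_laplacian => [|i]; last by rewrite card_ord.
congr (_ * _); first by apply: eq_bigr => i _; rewrite card_ord.
apply: eq_bigr => A _; congr (_ ^+ _); last by apply: eq_bigr => i _; rewrite card_ord.
by apply: eq_bigr => i _; rewrite card_ord.
Qed.
End ProductTrees.

Lemma dir_monomialE r (n : 'I_r -> nat) (S : {set {set prod_vertex n}}) :
  dir_monomial S
    = \prod_(e in S) direction_weight (fun i => 'X_i : {mpoly rat[r]}) e.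
Proof.
rewrite /direction_weight exchange_big; apply: eq_bigr => i _.
rewrite prodrXr; congr (_ ^+ _); rewrite -sum1_card.
rewrite big_mkcond [RHS]big_mkcond; apply: eq_bigr => e _ /=.
by rewrite inE; case: (e \in S) => //=; case: in_direction.
Qed.

Lemma prod_set_ge2 (R : comPzRingType) (I : finType) (F : {set I} -> R) :
  \prod_(A : {set I} | A != set0) F A
    = (\prod_i F [set i]) * \prod_(A : {set I} | (2 <= #|A|)%N) F A.
Proof.
rewrite (bigID (fun A : {set I} => #|A| == 1%N)) /=; congr (_ * _); last first.
  by apply: eq_bigl => A; rewrite -cards_eq0; case: #|A| => [|[|]].
rewrite -(big_imset F (in2W set1_inj)); apply: eq_bigl => A.
apply/andP/imsetP => [[_ /cards1P[i ->]]|[i _ ->]]; first by exists i.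
by rewrite cards1 -cards_eq0 cards1.
Qed.

Theorem theorem1 (r : nat) (n : 'I_r -> nat)
    (r_gt0 : (0 < r)%N) (n_gt0 : forall i : 'I_r, (0 < n i)%N) :
  \sum_(T in Tree (prod_complete (n := n))) dir_monomial T
    = (\prod_(i < r) (n i)%:R : rat)^-1 *:
        \prod_(A : {set 'I_r} | A != set0)
          (\sum_(i in A) ('X_i : {mpoly rat[r]}) *+ n i)
            ^+ (\prod_(i in A) (n i - 1))%N
  /\
  (\prod_(i < r) (n i)%:R : rat)^-1 *:
        \prod_(A : {set 'I_r} | A != set0)
          (\sum_(i in A) ('X_i : {mpoly rat[r]}) *+ n i)
            ^+ (\prod_(i in A) (n i - 1))%N
    = (\prod_(i < r)
         (((n i)%:R ^ ((n i)%:Z - 2%:Z) : rat) *: 'X_i ^+ (n i - 1)%N))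
      * \prod_(A : {set 'I_r} | (2 <= #|A|)%N)
          (\sum_(i in A) ('X_i : {mpoly rat[r]}) *+ n i)
            ^+ (\prod_(i in A) (n i - 1))%N.
Proof.
have n0 i : (n i)%:R != 0 :> rat by rewrite Num.Theory.pnatr_eq0 -lt0n.
have nMP i : (n i)%:R = (n i)%:R%:MP :> {mpoly rat[r]} by rewrite rmorph_nat.
split.
  rewrite (eq_bigr _ (fun T _ => dir_monomialE T)).
  rewrite product_tree_enumerator // => [|i]; last first.
    by rewrite nMP rmorph_unit // GRing.unitfE.
  rewrite -mul_mpolyC -prodfV rmorph_prod; congr (_ * _).
    by apply: eq_bigr => i _; rewrite nMP rmorphV // GRing.unitfE.
  apply: eq_bigr => A _; congr (_ ^+ _).
  by apply: eq_bigr => i _; rewrite mulr_natr.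
rewrite prod_set_ge2 scalerAl; congr (_ * _).
rewrite -prodfV -scaler_prod; apply: eq_bigr => i _.
rewrite !big_set1 exprMn_n -scaler_nat scalerA; congr (_ *: _).
rewrite natrX -(prednK (n_gt0 i)) subSS subn0.
have -> : (n i).-1.+1%:Z - 2%:Z = -1 + (n i).-1%:Z by lia.
by rewrite expfzDr // (prednK (n_gt0 i)).
Qed.
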